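(* Let $X$ and $Y$ be two one-sided shifts of finite type. Then $X$ and $Y$ are continuously orbit equivalent if and only if the groupoids $\mathcal{G}_X$ and $\mathcal{G}_Y$ are isomorphic (as topological groupoids).
   Context: $\mathbb{N}$ is the set of positive integers and $\mathbb{N}_0$ the set of non-negative integers. One-sided shift space: a closed subset $X\subseteq \boldsymbol{a}^{\mathbb{N}_0}$ ($\boldsymbol{a}$ a finite discrete alphabet, product topology) with $\sigma(X)=X$, where $(\sigma(x))_j=x_{j+1}$; $\sigma_X$ is the restriction of $\sigma$ to $X$. $\mathcal{L}(X)$ is the set of finite words (including the empty word) appearing in elements of $X$. $X$ is a one-sided shift of finite type if there is $m\in\mathbb{N}$ such that whenever $v\in\mathcal{L}(X)$ has length $m$ and $uv,vw\in\mathcal{L}(X)$, then $uvw\in\mathcal{L}(X)$. $X$ and $Y$ are continuously orbit equivalent if there is a homeomorphism $h:X\to Y$ and continuous maps $k,l:X\to\mathbb{N}_0$, $k',l':Y\to\mathbb{N}_0$ with $\sigma_Y^{k(x)}(h(\sigma_X(x)))=\sigma_Y^{l(x)}(h(x))$ for all $x\in X$ and $\sigma_X^{k'(y)}(h^{-1}(\sigma_Y(y)))=\sigma_X^{l'(y)}(h^{-1}(y))$ for all $y\in Y$. For a one-sided shift of finite type $X$, $\mathcal{G}_X:=\{(x,n,x')\in X\times\mathbb{Z}\times X:\exists i,j\in\mathbb{N}_0,\ n=i-j,\ \sigma_X^i(x)=\sigma_X^j(x')\}$ with unit space $X$ (identified with $\{(x,0,x):x\in X\}$), $r(x,n,x')=x$,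 $s(x,n,x')=x'$, $(x,n,x')(x',n',x'')=(x,n+n',x'')$, $(x,n,x')^{-1}=(x',-n,x)$. Its topology has as basis the sets $\{(x,i-j,x'):x\in U,\ x'\in U',\ \sigma_X^i(x)=\sigma_X^j(x')\}$ where $i,j\in\mathbb{N}_0$, $U,U'\subseteq X$ are open, $\sigma_X^i|_U$ and $\sigma_X^j|_{U'}$ are injective, and $\sigma_X^i(U)=\sigma_X^j(U')$. An isomorphism of topological groupoids is a bijective groupoid homomorphism that is a homeomorphism. *)

(* Defs.v *)
From HB Require Import structures.
From mathcomp Require Import all_boot all_order all_algebra.
From mathcomp Require Import all_classical topology zify.

Set Implicit Arguments.
Unset Strict Implicit.
Unset Printing Implicit Defensive.

Import Order.TTheory GRing.Theory Num.Theory.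

Local Open Scope classical_set_scope.

Definition homeomorphism {T U : topologicalType} (f : T -> U) (g : U -> T) :=
  [/\ cancel f g, cancel g f, continuous f & continuous g].

Definition full_shift (a : finType) : Type :=
  prod_topology (fun _ : nat => discrete_topology a).

HB.instance Definition _ (a : finType) := Topological.on (full_shift a).

Definition shift {a : finType} (x : full_shift a) : full_shift a :=
  fun j => x j.+1.

(* The empty shift space is not excluded. *)
Record shift_space (a : finType) := ShiftSpace {
  shift_set :> set (full_shift a);
  shift_closed : closed shift_set;
  shift_image : shift @` shift_set = shift_set }.

Definition language {a : finType} (X : set (full_shift a)) : set (seq a) :=
  [set w | exists (x : full_shift a) (i : nat),
    X x /\ w = mkseq (fun j => x (i + j)%N) (size w)].

Definition finite_type {a : finType} (X : set (full_shift a)) : Prop :=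
  exists2 m : nat, (0 < m)%N &
    forall u v w : seq a, language X v -> size v = m ->
      language X (u ++ v) -> language X (v ++ w) ->
      language X (u ++ v ++ w).

Record sft (a : finType) := SFT {
  sft_space :> shift_space a;
  sft_finite_type : finite_type sft_space }.

Lemma sigma_subproof {a : finType} (X : shift_space a) (x : X) :
  shift (val x) \in shift_set X.
Proof.
rewrite inE -[X in X _]shift_image; exists (val x) => //; exact: set_valP.
Qed.

(* [X] is coerced to the subtype of its points, whose canonical topology is
   the subspace topology. *)
Definition sigma {a : finType} (X : shift_space a) (x : X) : X :=
  exist _ (shift (val x)) (sigma_subproof x).

Definition continuously_orbit_equivalent {a b : finType}
    (X : shift_space a) (Y : shift_space b) : Prop :=
  exists (h : X -> Y) (hinv : Y -> X),
  exists (k l : X -> nat) (k' l' : Y -> nat),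
    [/\ homeomorphism h hinv,
        [/\ continuous k, continuous l, continuous k' & continuous l'],
        forall x, iter (k x) (@sigma b Y) (h (sigma x)) =
                  iter (l x) (@sigma b Y) (h x) &
        forall y, iter (k' y) (@sigma a X) (hinv (sigma y)) =
                  iter (l' y) (@sigma a X) (hinv y)].

Section sigma_open.
Context {a : finType}.

Definition cylinder (x : full_shift a) (N : nat) : set (full_shift a) :=
  [set y | forall i, (i < N)%N -> y i = x i].

Lemma full_shift_nbhs (x : full_shift a) (A : set (full_shift a)) :
  nbhs x A -> exists N : nat, cylinder x N `<=` A.
Proof.
pose F := filter_from [set: nat] (cylinder x).
have FF : Filter F.
  apply: filter_from_filter; first by exists 0%N.
  move=> i j _ _; exists (maxn i j) => // y Py.
  by split=> k ki; apply: Py; rewrite leq_max ki ?orbT.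
suff Fx : F --> x by move=> /Fx [N _ NA]; exists N.
apply/cvg_sup => i B [_ [[C oC <-] Cx CB]].
exists i.+1 => // y Py; apply: CB; rewrite /= /proj.
by have -> : y i = x i by apply: Py.
Qed.

Lemma cylinder_open (x : full_shift a) (N : nat) : open (cylinder x N).
Proof.
elim: N => [|N IH].
  by rewrite (_ : cylinder x 0 = setT); [exact: openT | apply/seteqP; split].
rewrite (_ : cylinder x N.+1 = cylinder x N `&`
    (proj N : full_shift a -> discrete_topology a) @^-1` [set x N]).
  apply: openI => //; apply: open_comp; last exact: discrete_open.
  by move=> y _; exact: (@proj_continuous nat (fun=> discrete_topology a) N y).
apply/seteqP; split=> y /=.
  by move=> Py; split=> [i iN|]; apply: Py => //; rewrite ltnS ltnW.
by move=> [Py yN] i; rewrite ltnS leq_eqVlt => /predU1P[->//|]; exact: Py.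
Qed.

Definition shift_cylinder (X : shift_space a) (x : X) (N : nat) : set X :=
  [set y | cylinder (val x) N (val y)].

Lemma shift_space_nbhs (X : shift_space a) (x : X) (A : set X) : nbhs x A ->
  exists N : nat, shift_cylinder x N `<=` A.
Proof.
move=> [_ [[B oB <-] Bx BA]].
have [N NB] : exists N : nat, cylinder (val x) N `<=` B.
  by apply: full_shift_nbhs; exact: open_nbhs_nbhs.
by exists N => y Py; apply: BA; exact: NB.
Qed.

Lemma shift_cylinder_open (X : shift_space a) (x : X) (N : nat) :
  open (shift_cylinder x N).
Proof. by exists (cylinder (val x) N) => //; exact: cylinder_open. Qed.

Lemma nbhs_shift_cylinder (X : shift_space a) (x : X) (N : nat) :
  nbhs x (shift_cylinder x N).
Proof. by apply: open_nbhs_nbhs; split; [exact: shift_cylinder_open|]. Qed.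

Lemma sigma_continuous (X : shift_space a) : continuous (@sigma a X).
Proof.
move=> x A /shift_space_nbhs [N NA].
apply: filterS (nbhs_shift_cylinder x N.+1).
by move=> y Py; apply: NA => i iN /=; apply: Py.
Qed.

Lemma language_prefix (X : shift_space a) (w : seq a) : language X w ->
  exists2 x : full_shift a, shift_set X x & w = mkseq x (size w).
Proof.
move=> [x [i [Xx ->]]]; exists (fun j => x (i + j)%N);
  last by rewrite size_mkseq.
elim: i => [|i IH] //; rewrite -[X in X _]shift_image.
exists (fun j => x (i + j)%N) => //.
by apply/funext => j; rewrite /shift addnS.
Qed.

Lemma prefix_language (X : shift_space a) (x : full_shift a) (N : nat) :
  shift_set X x -> language X (mkseq x N).
Proof. by move=> Xx; exists x, 0%N; split=> //; rewrite size_mkseq. Qed.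

Lemma mkseq_cons (f : nat -> a) (n : nat) :
  mkseq f n.+1 = f 0%N :: mkseq (fun i => f i.+1) n.
Proof.
by rewrite /mkseq -[iota 0 _]/(0%N :: iota 1 n) (iotaDl 1) /= -map_comp.
Qed.

Lemma mkseq_cat (f : nat -> a) (m n : nat) :
  mkseq f (m + n)%N = mkseq f m ++ mkseq (fun i => f (m + i)%N) n.
Proof.
by elim: m f => [|m IH] f //; rewrite addSn !mkseq_cons IH.
Qed.

Lemma sft_extend (X : sft a) : exists m : nat, forall x y : X,
  (forall i, (i < m)%N -> val y i = val x i.+1) ->
  exists z : X, val z 0%N = val x 0%N /\ sigma z = y.
Proof.
have [m m0 Xm] := sft_finite_type X; exists m => x y xy.
pose z : full_shift a := fun i => if i is j.+1 then val y j else val x 0%N.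
have Xz : shift_set X z.
  apply: (shift_closed (s := X)) => B /full_shift_nbhs [N NB].
  suff [t Xt tz] : exists2 t, shift_set X t &
      mkseq t (m + N).+1 = mkseq z (m + N).+1.
    exists t; split=> //; apply: NB => i iN.
    have iN' : (i < (m + N).+1)%N.
      by rewrite ltnS (leq_trans (ltnW iN)) ?leq_addl.
    by rewrite -(nth_mkseq (val x 0%N) t iN') tz nth_mkseq.
  have -> : mkseq z (m + N).+1 =
      [:: val x 0%N] ++ mkseq (val y) m ++ mkseq (fun i => val y (m + i)%N) N.
    by rewrite mkseq_cons (mkseq_cat _ m N).
  have Xy : shift_set X (val y) := set_valP y.
  have Xx : shift_set X (val x) := set_valP x.
  set w := _ ++ _; suff Lw : language X w.
    have [t Xt ->] := language_prefix Lw; exists t => //.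
    by rewrite size_cat size_cat !size_mkseq.
  apply: Xm; rewrite ?size_mkseq //; first exact: prefix_language.
    have -> : [:: val x 0%N] ++ mkseq (val y) m = mkseq (val x) m.+1.
      rewrite mkseq_cons; congr cons; apply/eq_in_map => i.
      by rewrite mem_iota /= => /xy.
    exact: prefix_language.
  by rewrite -mkseq_cat; exact: prefix_language.
exists (exist _ z (mem_set Xz)); split=> //.
by apply: val_inj; apply/funext.
Qed.

Lemma sigma_open (X : sft a) (U : set X) : open U -> open (@sigma a X @` U).
Proof.
move=> oU; rewrite openE => _ [x Ux <-]; rewrite /interior.
have [N NU] := shift_space_nbhs (open_nbhs_nbhs (conj oU Ux)).
have [m Xm] := sft_extend X.
apply: filterS (nbhs_shift_cylinder (sigma x) (m + N)).
move=> y Py.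
have [i im|z [z0 zy]] := Xm x y; first by apply: Py; rewrite ltn_addr.
exists z => //; apply: NU => -[|i] iN //=.
have -> : val z i.+1 = val y i by rewrite -zy.
by apply: Py; rewrite (leq_trans (ltnW iN)) ?leq_addl.
Qed.

Lemma iter_sigma_open (X : sft a) (U : set X) (i : nat) :
  open U -> open (iter i (@sigma a X) @` U).
Proof.
move=> oU; elim: i => [|i /sigma_open oi]; first by rewrite image_id.
rewrite (_ : _ @` _ = @sigma a X @` (iter i (@sigma a X) @` U)) //.
by rewrite image_comp.
Qed.

Lemma iter_sigma_continuous (X : shift_space a) (i : nat) :
  continuous (iter i (@sigma a X)).
Proof.
elim: i => [|i IH] x; first exact: cvg_id.
exact: (continuous_comp (IH x) (@sigma_continuous X _)).
Qed.

Lemma val_iter_sigma (X : shift_space a) (i j : nat) (x : X) :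
  val (iter i (@sigma a X) x) j = val x (i + j)%N.
Proof. by elim: i j => [|i IH] j //=; rewrite /shift IH addSnnS. Qed.

Lemma iter_sigma_inj (X : shift_space a) (x : X) (i : nat) :
  set_inj (shift_cylinder x i) (iter i (@sigma a X)).
Proof.
move=> y z; rewrite !inE => Py Pz yz; apply: val_inj; apply/funext => j.
have [ji|ij] := ltnP j i; first by rewrite Py // Pz.
by rewrite -(subnKC ij) -!val_iter_sigma yz.
Qed.

End sigma_open.

Section groupoid.
Context {a : finType} (X : sft a).

Definition groupoid_set : set (X * int * X) :=
  [set g | exists i j : nat, g.1.2 = (i%:Z - j%:Z)%R /\
     iter i (@sigma a X) g.1.1 = iter j (@sigma a X) g.2].

(* A separate name, so that the groupoid does not inherit the subspace
   topology of the product. *)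
Definition groupoid : Type := groupoid_set.

HB.instance Definition _ := Choice.copy groupoid (set_type groupoid_set).

Definition grange (g : groupoid) : X := (\val g).1.1.
Definition gdegree (g : groupoid) : int := (\val g).1.2.
Definition gsource (g : groupoid) : X := (\val g).2.

Definition composable (g g' : groupoid) : Prop := gsource g = grange g'.

Lemma gmul_subproof (g g' : groupoid) : composable g g' ->
  (grange g, gdegree g + gdegree g', gsource g')%R \in groupoid_set.
Proof.
move: g g' => [[[x n] y] gP] [[[y' n'] z] gP'].
rewrite /composable /grange /gdegree /gsource /= => yy'; move: gP gP'.
rewrite !inE -{}yy' => -[i [j [/= -> xy]]] [i' [j' [/= -> yz]]].
exists (i' + i)%N, (j + j')%N; split=> /=.
  by rewrite !PoszD opprD addrACA [(i%:Z + _)%R]addrC.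
by rewrite iterD xy -iterD addnC iterD yz -iterD.
Qed.

Definition gmul (g g' : groupoid) (c : composable g g') : groupoid :=
  exist _ (grange g, gdegree g + gdegree g', gsource g')%R (gmul_subproof c).

Lemma gunit_subproof (x : X) : (x, 0%R, x) \in groupoid_set.
Proof. by rewrite inE; exists 0%N, 0%N. Qed.

Definition gunit (x : X) : groupoid := exist _ (x, 0%R, x) (gunit_subproof x).

Lemma ginv_subproof (g : groupoid) :
  (gsource g, - gdegree g, grange g)%R \in groupoid_set.
Proof.
have [i [j [dg eg]]] := set_valP g; apply/mem_set; exists j, i.
by split=> //=; rewrite /gdegree dg opprB.
Qed.

Definition ginv (g : groupoid) : groupoid :=
  exist _ (gsource g, - gdegree g, grange g)%R (ginv_subproof g).

Lemma groupoid_eq (g g' : groupoid) : grange g = grange g' ->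
  gdegree g = gdegree g' -> gsource g = gsource g' -> g = g'.
Proof.
move=> rg dg sg; apply: val_inj; rewrite [LHS]surjective_pairing.
by rewrite [(\val g).1]surjective_pairing [RHS]surjective_pairing
  [(\val g').1]surjective_pairing; congr (_, _, _).
Qed.

Definition gbasic_index : Type := nat * nat * set X * set X.

HB.instance Definition _ := Pointed.on gbasic_index.

Definition gbasic_admissible : set gbasic_index :=
  [set p | let: (i, j, U, U') := p in
    [/\ open U, open U', set_inj U (iter i (@sigma a X)),
        set_inj U' (iter j (@sigma a X)) &
        iter i (@sigma a X) @` U = iter j (@sigma a X) @` U']].

Definition gbasic (p : gbasic_index) : set groupoid :=
  let: (i, j, U, U') := p in
  [set g | [/\ U (grange g), U' (gsource g), gdegree g = (i%:Z - j%:Z)%R &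
    iter i (@sigma a X) (grange g) = iter j (@sigma a X) (gsource g)]].

Lemma gbasic_shrink (i j : nat) (U U' : set X) (g : groupoid) :
    open U -> open U' ->
    set_inj U (iter i (@sigma a X)) -> set_inj U' (iter j (@sigma a X)) ->
    gbasic (i, j, U, U') g ->
  exists W W', [/\ W `<=` U, W' `<=` U', gbasic_admissible (i, j, W, W') &
    gbasic (i, j, W, W') g].
Proof.
move=> oU oU' iU iU' [Ug U'g dg eg].
pose O := (iter i (@sigma a X) @` U) `&` (iter j (@sigma a X) @` U').
have oO : open O by apply: openI; exact: iter_sigma_open.
have oP k : open (iter k (@sigma a X) @^-1` O).
  by apply: open_comp => // x _; exact: iter_sigma_continuous.
exists (U `&` iter i (@sigma a X) @^-1` O).
exists (U' `&` iter j (@sigma a X) @^-1` O).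
have subinj (A B : set X) f : set_inj A f -> set_inj (A `&` B) f.
  by move=> iA x y; rewrite !inE => -[Ax _] [Ay _]; apply: iA; rewrite inE.
split; [by move=> ? []|by move=> ? []| |].
  split; [exact: openI|exact: openI|exact: subinj|exact: subinj|].
  apply/seteqP; split=> y [x [Ax Ox] <-].
    by have [_ [x' Ux' x'x]] := Ox; exists x' => //; split=> //=; rewrite x'x.
  by have [[x' Ux' x'x] _] := Ox; exists x' => //; split=> //=; rewrite x'x.
split=> //; split=> //=; split; [by exists (grange g)|by exists (gsource g)|..].
  by exists (grange g).
by exists (gsource g).
Qed.

Lemma gbasic_cover : \bigcup_(p in gbasic_admissible) gbasic p = setT.
Proof.
apply/seteqP; split=> // g _.
have [i [j [dg eg]]] := set_valP g.
have [||||//|W [W' [_ _ WD Wg]]] := @gbasic_shrink i j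
  (shift_cylinder (grange g) i) (shift_cylinder (gsource g) j) g.
- exact: shift_cylinder_open.
- exact: shift_cylinder_open.
- exact: iter_sigma_inj.
- exact: iter_sigma_inj.
by exists (i, j, W, W').
Qed.

Lemma gbasic_join p q g : gbasic_admissible p -> gbasic_admissible q ->
  gbasic p g -> gbasic q g ->
  exists r, [/\ gbasic_admissible r, gbasic r g &
    gbasic r `<=` gbasic p `&` gbasic q].
Proof.
wlog : p q / (p.1.1.1 <= q.1.1.1)%N.
  move=> H pD qD pg qg; have [pq|qp] := leqP p.1.1.1 q.1.1.1; first exact: H.
  have [r [rD rg rqp]] := H _ _ (ltnW qp) qD pD qg pg.
  by exists r; rewrite setIC.
move: p q => [[[i j] U] U'] [[[k l] V] V'] /= ik.
move=> [oU oU' iU iU' _] [oV oV' _ _ _] [Ug U'g dg eg] [Vg V'g dg' eg'].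
have lE : l = (k - i + j)%N.
  apply/eqP; rewrite -eqz_nat PoszD -subzn //; apply/eqP.
  have : (i%:Z - j%:Z = k%:Z - l%:Z :> int)%R by rewrite -dg.
  by move: (k : int) (l : int) (i : int) (j : int) => *; lia.
have subinj (A B : set X) f : set_inj A f -> set_inj (A `&` B) f.
  by move=> iA x y; rewrite !inE => -[Ax _] [Ay _]; apply: iA; rewrite inE.
have [||||//|W [W' [WUV WUV' WD Wg]]] :=
  @gbasic_shrink i j (U `&` V) (U' `&` V') g.
- exact: openI.
- exact: openI.
- exact: subinj.
- exact: subinj.
exists (i, j, W, W'); split=> // x [/WUV[Ux Vx] /WUV'[U'x V'x] dx ex].
split; split=> //; first by rewrite dx -dg.
by rewrite lE -{1}(subnK ik) !iterD ex.
Qed.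

HB.instance Definition _ :=
  isBaseTopological.Build groupoid gbasic_cover gbasic_join.

End groupoid.

Definition groupoid_hom {a b : finType} (X : sft a) (Y : sft b)
    (phi : groupoid X -> groupoid Y) : Prop :=
  forall (g g' : groupoid X) (c : composable g g'),
    exists c' : composable (phi g) (phi g'), phi (gmul c) = gmul c'.

Lemma groupoid_hom_unit {a b : finType} (X : sft a) (Y : sft b)
    (phi : groupoid X -> groupoid Y) : groupoid_hom phi ->
  forall x, phi (gunit x) = gunit (grange (phi (gunit x))).
Proof.
move=> H x; have c : composable (gunit x) (gunit x) by [].
have [c' e] := H _ _ c.
have cE : gmul c = gunit x by exact: groupoid_eq.
rewrite cE in e; apply: groupoid_eq => //=.
move/(congr1 (@gdegree _ _)): e => /eqP.
by rewrite -subr_eq0 opprD addNKr oppr_eq0 => /eqP.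
Qed.

Lemma groupoid_hom_inv {a b : finType} (X : sft a) (Y : sft b)
    (phi : groupoid X -> groupoid Y) : groupoid_hom phi ->
  forall g, phi (ginv g) = ginv (phi g).
Proof.
move=> H g; have c : composable g (ginv g) by [].
have [c' e] := H _ _ c.
have cE : gmul c = gunit (grange g).
  by apply: groupoid_eq => //; rewrite /gdegree /= subrr.
rewrite cE (groupoid_hom_unit H) in e; apply: groupoid_eq.
- exact: esym c'.
- have : (gdegree (phi g) + gdegree (phi (ginv g)) = 0)%R :=
    esym (congr1 (@gdegree _ _) e).
  by move/eqP; rewrite addrC addr_eq0 => /eqP.
- exact: etrans (esym (congr1 (@gsource _ _) e)) (congr1 (@grange _ _) e).
Qed.

Definition groupoid_isomorphic {a b : finType} (X : sft a) (Y : sft b) : Prop :=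
  exists (phi : groupoid X -> groupoid Y) (psi : groupoid Y -> groupoid X),
    homeomorphism phi psi /\ groupoid_hom phi.

(* Main.v *)
(* A continuous orbit equivalence [h] gives a locally constant integer function
   [n] such that [x |-> (h x, n x, h (sigma x))] is a continuous map into the
   groupoid of [Y]; summing [n] along orbits extends it to a groupoid morphism
   covering [h].  Composing with the morphism obtained from the inverse of [h]
   gives the identity on every arrow between non-isolated points, because an
   arrow whose degree changes forces a whole neighbourhood of its range to be
   eventually periodic with bounded period.  Isolated points are eventually
   periodic, and there the morphism may fail to be bijective on isotropy; this
   is repaired by changing [n] at one point of each isolated cycle.
   Conversely an isomorphism restricts to a homeomorphism of unit spaces, and
   the images of the arrows [(x, 1, sigma x)] give the orbit equivalence. *)
Require Import Defs.
From mathcomp Require Import all_boot all_order all_algebra.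
From mathcomp Require Import all_classical topology zify.

Set Implicit Arguments.
Unset Strict Implicit.
Unset Printing Implicit Defensive.

Import Order.TTheory GRing.Theory Num.Theory.

Local Open Scope classical_set_scope.
Local Open Scope ring_scope.

Local Notation sigma_n i := (iter i (@sigma _ _)).

(** * Arrows of the groupoid and isotropy groups *)

Section Arrows.
Context {a : finType} (X : sft a).
Implicit Types (x y z : X) (g : groupoid X).

Definition arrow x (d : int) y : Prop := @groupoid_set a X (x, d, y).

Lemma arrowP g : arrow (grange g) (gdegree g) (gsource g).
Proof.
by have [i [j [? ?]]] := set_valP g; exists i, j.
Qed.

Definition mk_arrow x d y (H : arrow x d y) : groupoid X :=
  exist _ (x, d, y) (mem_set H).

Lemma arrow_unit x : arrow x 0 x.
Proof. by exists 0%N, 0%N. Qed.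

Lemma arrow_mul x d y e z : arrow x d y -> arrow y e z -> arrow x (d + e) z.
Proof.
move=> H H'; have c : composable (mk_arrow H) (mk_arrow H') by [].
exact: (arrowP (gmul c)).
Qed.

Lemma arrow_inv x d y : arrow x d y -> arrow y (- d) x.
Proof. move=> H; exact: (arrowP (ginv (mk_arrow H))). Qed.

Lemma arrow_sigma i x : arrow x i%:Z (sigma_n i x).
Proof. by exists i, 0%N; rewrite subr0. Qed.

Lemma arrow_mulz x d (t : int) : arrow x d x -> arrow x (t * d) x.
Proof.
move=> H.
have N (n : nat) : arrow x (n%:Z * d) x.
  elim: n => [|n IH]; first by rewrite mul0r; exact: arrow_unit.
  by rewrite intS mulrDl mul1r; exact: arrow_mul IH.
case: t => [n|n]; first exact: N.
by rewrite NegzE mulNr; apply: arrow_inv; exact: N.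
Qed.

(** The degrees of loops at [x] form a subgroup of the integers, non-trivial because of [m]. Its
    least positive element generates it, by division with remainder. *)
Lemma isotropy_gen x (m : int) : m != 0 -> arrow x m x ->
  exists2 p : nat, (0 < p)%N &
    forall d, arrow x d x <-> exists t : int, d = t * p%:Z.
Proof.
move=> m0 xm.
have ex : exists p : nat, (0 < p)%N && `[< arrow x p%:Z x >].
  exists `|m|%N; rewrite absz_gt0 m0 /=; apply/asboolP.
  rewrite -[_%:Z]/(`|m|%:Z) abszE; case: (ger0P m) => // _; exact: arrow_inv.
case: (ex_minnP ex) => p /andP[p0 /asboolP xp] pmin.
exists p => // d; split=> [xd|[t ->]]; last exact: arrow_mulz.
exists (d %/ p%:Z)%Z; rewrite {1}(divz_eq d p%:Z).
suff -> : (d %% p%:Z)%Z = 0 by rewrite addr0.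
have p0' : p%:Z != 0 by rewrite eqz_nat -lt0n.
have r0 := modz_ge0 d p0'.
have rp : (d %% p%:Z)%Z < p%:Z by apply: ltz_pmod; rewrite ltz_nat.
have xr : arrow x (d %% p%:Z)%Z x.
  have -> : (d %% p%:Z)%Z = d + (- (d %/ p%:Z)%Z) * p%:Z.
    by rewrite mulNr; apply/eqP; rewrite eq_sym subr_eq addrC -divz_eq.
  by apply: (arrow_mul xd); exact: arrow_mulz.
case: (d %% p%:Z)%Z r0 rp xr => // r _ rp xr.
case: r rp xr => // r rp xr.
have := pmin r.+1; rewrite /= => /(_ (asboolT xr)).
by rewrite leqNgt -ltz_nat rp.
Qed.

End Arrows.

(** * The étale topology of the groupoid *)

Section Topology.
Context {a : finType} (X : sft a).
Implicit Types (x y z : X) (g : groupoid X).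

Lemma nbhs_gbasic g (A : set (groupoid X)) : nbhs g A ->
  exists p, [/\ gbasic_admissible p, gbasic p g & gbasic p `<=` A].
Proof.
move=> [B [[D DB <-] [p Dp pg] BA]].
by exists p; split=> //; [exact: DB|move=> z zp; apply: BA; exists p].
Qed.

Lemma gbasic_nbhs g p : gbasic_admissible p -> gbasic p g ->
  nbhs g (gbasic p).
Proof.
move=> Dp pg; exists (gbasic p); split=> //.
by exists [set p] => [q -> //|]; rewrite bigcup_set1.
Qed.

(** On cylinders of lengths [i] and [j] the iterates of [sigma] are injective, so [gbasic_shrink]
    supplies an admissible basic set inside the given neighbourhoods. *)
Lemma gbasic_nbhs_cylinder i j (U U' : set X) g :
    gdegree g = i%:Z - j%:Z ->
    sigma_n i (grange g) = sigma_n j (gsource g) ->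
    nbhs (grange g) U -> nbhs (gsource g) U' ->
  nbhs g [set g' | [/\ U (grange g'), U' (gsource g'), gdegree g' = gdegree g &
    sigma_n i (grange g') = sigma_n j (gsource g')]].
Proof.
rewrite 2!nbhsE => dg eg [V [oV Vg] VU] [V' [oV' V'g] VU'].
have subinj (A B : set X) f : set_inj B f -> set_inj (A `&` B) f.
  by move=> iA x y; rewrite !inE => -[_ Ax] [_ Ay]; apply: iA; rewrite inE.
have [| | | | |W [W' [WV WV' WD Wg]]] := @gbasic_shrink _ X i j
  (V `&` shift_cylinder (grange g) i) (V' `&` shift_cylinder (gsource g) j) g.
- by apply: openI => //; exact: shift_cylinder_open.
- by apply: openI => //; exact: shift_cylinder_open.
- by apply: subinj; exact: iter_sigma_inj.
- by apply: subinj; exact: iter_sigma_inj.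
- by split=> //; split.
apply: filterS (gbasic_nbhs WD Wg) => g' [/WV[Vg' _] /WV'[V'g' _] dg' eg'].
by split; [exact: VU|exact: VU'|rewrite dg|].
Qed.

Lemma grange_continuous : continuous (@grange a X).
Proof.
move=> g U Ug; have [i [j [dg eg]]] := arrowP g.
by apply: filterS (gbasic_nbhs_cylinder dg eg Ug filterT) => g' [].
Qed.

Lemma gsource_continuous : continuous (@gsource a X).
Proof.
move=> g U Ug; have [i [j [dg eg]]] := arrowP g.
by apply: filterS (gbasic_nbhs_cylinder dg eg filterT Ug) => g' [].
Qed.

(** The equality of images in an admissible index gives each point of [U] a partner in [U'], hence
    an arrow of the basic set with that range. *)
Lemma grange_open g (A : set (groupoid X)) : nbhs g A ->
  nbhs (grange g) (@grange a X @` A).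
Proof.
move=> /nbhs_gbasic[[[[i j] U] U'] [[oU oU' _ _ UU'] [Ug U'g _ _] UA]].
have : nbhs (grange g) U by exact: open_nbhs_nbhs.
apply: filterS => y Uy.
have : [set sigma_n i z | z in U] (sigma_n i y) by exists y.
rewrite UU' => -[z U'z zy].
have yz : arrow y (i%:Z - j%:Z) z by exists i, j.
by exists (mk_arrow yz) => //; apply: UA.
Qed.

Lemma gbasic_inj p : gbasic_admissible p -> set_inj (gbasic p) (@grange a X).
Proof.
move: p => [[[i j] U] U'] [_ _ _ iU' _] g g'.
rewrite !inE => -[_ Ug dg eg] [_ Ug' dg' eg'] rr.
apply: groupoid_eq => //; first by rewrite dg.
by apply: iU'; rewrite ?inE // -eg rr eg'.
Qed.

End Topology.

(* [n] is locally constant and [t |-> (u t, n t, v t)] is continuous into the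
   groupoid of [Y], near [t]. *)
Definition lag_at {T : topologicalType} {b : finType} {Y : sft b}
    (u v : T -> Y) (n : T -> int) (t : T) : Prop :=
  exists i j : nat, n t = i%:Z - j%:Z /\
    \forall t' \near t, n t' = n t /\ sigma_n i (u t') = sigma_n j (v t').

Definition lag {T : topologicalType} {b : finType} {Y : sft b}
    (u v : T -> Y) (n : T -> int) : Prop := forall t, lag_at u v n t.

(** * Calculus of lags *)

Section Lag.
Context {T : topologicalType} {b : finType} {Y : sft b}.
Implicit Types (u v w : T -> Y) (n m : T -> int) (t : T).

Lemma lag_at_arrow u v n t : lag_at u v n t -> arrow (u t) (n t) (v t).
Proof. by move=> [i [j [nt /nbhs_singleton[_ e]]]]; exists i, j. Qed.

Lemma lag_at_near u v n u' v' n' t :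
  (\forall t' \near t, [/\ u' t' = u t', v' t' = v t' & n' t' = n t']) ->
  lag_at u v n t -> lag_at u' v' n' t.
Proof.
move=> H [i [j [nt L]]]; have [_ _ n't] := nbhs_singleton H.
exists i, j; rewrite n't; split=> //.
by apply: filterS2 H L => t' [-> -> ->].
Qed.

Lemma lag_at_eq u v n u' v' n' t :
  u' =1 u -> v' =1 v -> n' =1 n -> lag_at u v n t -> lag_at u' v' n' t.
Proof. by move=> eu ev en; apply: lag_at_near; apply: nearW. Qed.

Lemma lag_at_add u v w n m t :
  lag_at u v n t -> lag_at v w m t -> lag_at u w (n \+ m) t.
Proof.
move=> [i [j [nt L]]] [k [l [mt L']]].
(* Both equations are iterated until they meet at the iterate of order [j + k] of [v]. *)
exists (k + i)%N, (j + l)%N; split; first by rewrite /= nt mt !PoszD; lia.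
apply: filterS2 L L' => t' [/= -> e] [-> e']; split=> //.
by rewrite iterD e -iterD addnC iterD e' -iterD.
Qed.

Lemma lag_at_opp u v n t : lag_at u v n t -> lag_at v u (\- n) t.
Proof.
move=> [i [j [nt L]]]; exists j, i; split; first by rewrite /= nt opprB.
by apply: filterS L => t' [/= -> ->].
Qed.

Lemma lag_at_comp (S : topologicalType) (f : S -> T) u v n s :
  {for s, continuous f} -> lag_at u v n (f s) ->
  lag_at (u \o f) (v \o f) (n \o f) s.
Proof.
move=> fs [i [j [nt L]]]; exists i, j; split=> //.
exact: (fs _ L).
Qed.

Lemma lag_const u v n (i j : nat) :
  (forall t, n t = i%:Z - j%:Z) ->
  (forall t, sigma_n i (u t) = sigma_n j (v t)) ->
  lag u v n.
Proof.
by move=> nE e t; exists i, j; split=> //; apply: nearW => t'; rewrite !nE.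
Qed.

Lemma lag_refl u : lag u u (fun=> 0).
Proof. exact: (@lag_const _ _ _ 0%N 0%N). Qed.

Lemma lag_at_isolated u v n t : nbhs t [set t] ->
  arrow (u t) (n t) (v t) -> lag_at u v n t.
Proof.
move=> t1 [i [j [nt e]]]; exists i, j; split=> //.
by apply: filterS t1 => _ ->.
Qed.

Lemma lag_comp (S : topologicalType) (f : S -> T) u v n :
  continuous f -> lag u v n -> lag (u \o f) (v \o f) (n \o f).
Proof. by move=> cf L s; apply: lag_at_comp; [exact: cf|exact: L]. Qed.

End Lag.

Lemma groupoid_lag {b : finType} (Y : sft b) :
  lag (@grange b Y) (@gsource b Y) (@gdegree b Y).
Proof.
move=> g; have [i [j [dg eg]]] := arrowP g.
exists i, j; split=> //.
by apply: filterS (gbasic_nbhs_cylinder dg eg filterT filterT) => g' [].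
Qed.

(** The exponents of the lag need not be those of the target basic set. Only their differences
    agree, so the equation for [(k, l)] must be derived from the one for [(i, j)]. *)
Lemma lag_continuous {b : finType} (Y : sft b) (T : topologicalType)
    (f : T -> groupoid Y) :
  continuous (@grange b Y \o f) -> continuous (@gsource b Y \o f) ->
  lag (@grange b Y \o f) (@gsource b Y \o f) (@gdegree b Y \o f) ->
  continuous f.
Proof.
move=> cr cs L t; have {L} [i [j [dt H]]] := L t.
move=> A /nbhs_gbasic.
move=> [[[[k l] U] U'] [[oU oU' iU iU' UU'] [Ut U't dt' et] UA]].
rewrite /= in dt dt' et.
(* Large enough that the coordinates [m] not covered by closeness satisfy [i + j <= m], so that
   [m + k - i] below is not truncated. *)
pose N := (i + k + j + l)%N.
have nU : nbhs (grange (f t)) (U `&` shift_cylinder (grange (f t)) N).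
  by apply: filterI; [exact: open_nbhs_nbhs|exact: nbhs_shift_cylinder].
have nU' : nbhs (gsource (f t)) (U' `&` shift_cylinder (gsource (f t)) N).
  by apply: filterI; [exact: open_nbhs_nbhs|exact: nbhs_shift_cylinder].
suff {UA} : \forall t' \near t, gbasic (k, l, U, U') (f t').
  by apply: filterS => t' /UA.
have {}nU : \forall t' \near t,
  (U `&` shift_cylinder (grange (f t)) N) (grange (f t')) := cr t _ nU.
have {}nU' : \forall t' \near t,
  (U' `&` shift_cylinder (gsource (f t)) N) (gsource (f t')) := cs t _ nU'.
apply: filterS3 nU nU' H.
move=> t' /= [Ut' rN] [U't' sN] [dt2 e].
split=> //; first by rewrite dt2 dt'.
(* For the first coordinates use closeness to [f t], beyond them the tail
   equality with [(i, j)]. *)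
apply: val_inj; apply/funext => m; rewrite !val_iter_sigma.
have [mN|Nm] := ltnP (m + k + l) N.
  rewrite rN ?sN; [|lia|lia].
  by rewrite -2!val_iter_sigma et.
have kl : (k + j = l + i)%N by lia.
have := congr1 (fun w : Y => val w (m + k - i)%N) e.
rewrite !val_iter_sigma.
have -> : (i + (m + k - i) = k + m)%N by lia.
by have -> : (j + (m + k - i) = l + m)%N by lia.
Qed.

Lemma gunit_continuous {a : finType} (X : sft a) : continuous (@gunit a X).
Proof.
apply: lag_continuous.
- by move=> x; exact: cvg_id.
- by move=> x; exact: cvg_id.
- exact: lag_refl.
Qed.

(** * The integer cocycle generated by a function on the space *)

Section Cocycle.
Context {a : finType} (X : sft a).
Implicit Types (n : X -> int) (x y z : X).

Definition birkhoff n (N : nat) x : int := \sum_(r < N) n (sigma_n r x).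

Lemma birkhoff_add n N M x :
  birkhoff n (N + M) x = birkhoff n N x + birkhoff n M (sigma_n N x).
Proof.
rewrite /birkhoff big_split_ord /=; congr (_ + _).
by apply: eq_bigr => r _; rewrite addnC iterD.
Qed.

(** The additive extension to all arrows of the assignment of [n x] to [(x, 1, sigma x)]. It is a
    relation because an arrow does not determine the exponents [i] and [j]. *)
Definition cocycle n x (d : int) y (v : int) : Prop :=
  exists i j : nat, [/\ d = i%:Z - j%:Z, sigma_n i x = sigma_n j y &
    v = birkhoff n i x - birkhoff n j y].

Lemma cocycle_ex n x d y : arrow x d y -> exists v, cocycle n x d y v.
Proof.
by move=> [i [j [dE e]]]; exists (birkhoff n i x - birkhoff n j y), i, j.
Qed.

Lemma cocycle_arrow n x d y v : cocycle n x d y v -> arrow x d y.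
Proof. by move=> [i [j [? ? _]]]; exists i, j. Qed.

(** Two exponent pairs for one arrow differ by the same amount in both entries. The larger pair adds
    to both sums the same terms, taken from the common point on, and these cancel. *)
Lemma cocycle_fun n x d y v w :
  cocycle n x d y v -> cocycle n x d y w -> v = w.
Proof.
move=> [i [j [dE e vE]]] [k [l [dE' e' wE]]].
wlog ik : i j k l v w dE e vE dE' e' wE / (i <= k)%N.
  move=> H; case/orP: (leq_total i k) => ik; first exact: (H i j k l).
  by apply: esym; exact: (H k l i j).
have kE : k = (i + (k - i))%N by lia.
have lE : l = (j + (k - i))%N by lia.
rewrite vE wE kE lE !birkhoff_add e.
by rewrite opprD addrACA subrr addr0.
Qed.

Lemma cocycle_sig n x i : cocycle n x i%:Z (sigma_n i x) (birkhoff n i x).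
Proof.
by exists i, 0%N; rewrite subr0 /birkhoff big_ord0 subr0.
Qed.

Lemma cocycle_unit n x : cocycle n x 0 x 0.
Proof. by have := cocycle_sig n x 0; rewrite /birkhoff big_ord0. Qed.

Lemma cocycle_mul n x d y e z v w : cocycle n x d y v -> cocycle n y e z w ->
  cocycle n x (d + e) z (v + w).
Proof.
move=> [i [j [-> e1 ->]]] [k [l [-> e2 ->]]].
exists (i + k)%N, (l + j)%N; split; first by lia.
  by rewrite addnC iterD e1 -iterD addnC iterD e2 -iterD addnC.
rewrite !birkhoff_add e1 -e2.
(* One sum along the orbit of [y], split in two ways. *)
have : birkhoff n (j + k) y = birkhoff n (k + j) y by rewrite addnC.
by rewrite !birkhoff_add; lia.
Qed.

Lemma cocycle_inv n x d y v : cocycle n x d y v -> cocycle n y (- d) x (- v).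
Proof.
by move=> [i [j [-> e ->]]]; exists j, i; rewrite e !opprB.
Qed.

Lemma cocycle_mulz n x d v (t : int) : cocycle n x d x v ->
  cocycle n x (t * d) x (t * v).
Proof.
move=> H.
have N (m : nat) : cocycle n x (m%:Z * d) x (m%:Z * v).
  elim: m => [|m IH]; first by rewrite !mul0r; exact: cocycle_unit.
  by rewrite intS !mulrDl !mul1r; exact: cocycle_mul IH.
case: t => [m|m]; first exact: N.
by rewrite NegzE !mulNr; apply: cocycle_inv; exact: N.
Qed.

Definition cocycle_of n (g : groupoid X) : int :=
  projT1 (cid (cocycle_ex n (arrowP g))).

Lemma cocycle_ofP n g :
  cocycle n (grange g) (gdegree g) (gsource g) (cocycle_of n g).
Proof. exact: projT2 (cid (cocycle_ex n (arrowP g))). Qed.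

Lemma cocycle_ofE n g v :
  cocycle n (grange g) (gdegree g) (gsource g) v -> cocycle_of n g = v.
Proof. exact/cocycle_fun/cocycle_ofP. Qed.

End Cocycle.

(** * The groupoid morphism induced by a lag *)

Section LagCocycle.
Context {a b : finType} (X : sft a) (Y : sft b) (h : X -> Y) (n : X -> int).
Context (hn : lag h (h \o @sigma a X) n).

Lemma lag_birkhoff N : lag h (h \o sigma_n N) (birkhoff n N).
Proof.
elim: N => [|N IH] x.
  apply: lag_at_eq (lag_refl h x) => // y.
  by rewrite /birkhoff big_ord0.
have L : lag_at (h \o sigma_n N) (h \o sigma_n N.+1) (n \o sigma_n N) x.
  apply: (@lag_at_comp _ _ _ _ (sigma_n N) h (h \o @sigma a X)); last exact: hn.
  exact: iter_sigma_continuous.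
apply: lag_at_eq (lag_at_add (IH x) L) => // y.
by rewrite /birkhoff big_ord_recr.
Qed.

(** Near [g] one pair of exponents serves all arrows, so the cocycle is a difference of two Birkhoff
    sums. Their lags can be composed because the iterates of range and source coincide there. *)
Lemma lag_cocycle_of :
  lag (h \o @grange a X) (h \o @gsource a X) (cocycle_of n).
Proof.
move=> g; have [i [j [dg eg]]] := arrowP g.
have L : lag_at (h \o @grange a X) (h \o sigma_n i \o @grange a X)
    (birkhoff n i \o @grange a X) g.
  exact: (lag_comp (@grange_continuous _ X) (lag_birkhoff i) g).
have L' : lag_at (h \o @gsource a X) (h \o sigma_n j \o @gsource a X)
    (birkhoff n j \o @gsource a X) g.
  exact: (lag_comp (@gsource_continuous _ X) (lag_birkhoff j) g).
have {}L' : lag_at (h \o sigma_n i \o @grange a X) (h \o @gsource a X)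
    (\- (birkhoff n j \o @gsource a X)) g.
  apply: lag_at_near (lag_at_opp L').
  apply: filterS (gbasic_nbhs_cylinder dg eg filterT filterT).
  by move=> g' [_ _ _ /= ->].
apply: lag_at_near (lag_at_add L L').
apply: filterS (gbasic_nbhs_cylinder dg eg filterT filterT).
move=> g' [_ _ dg' /= eg']; split=> //.
by apply: cocycle_ofE; exists i, j; rewrite dg'.
Qed.

Lemma cocycle_lag_arrow x d y v : cocycle n x d y v -> arrow (h x) v (h y).
Proof.
move=> H; have := lag_at_arrow (lag_cocycle_of (mk_arrow (cocycle_arrow H))).
by rewrite (cocycle_ofE (v := v)).
Qed.

Definition lag_morphism (g : groupoid X) : groupoid Y :=
  mk_arrow (lag_at_arrow (lag_cocycle_of g)).

Lemma lag_morphism_hom : groupoid_hom lag_morphism.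
Proof.
move=> g g' c.
have c' : composable (lag_morphism g) (lag_morphism g') := congr1 h c.
exists c'; apply: groupoid_eq => //.
apply: cocycle_ofE; apply: cocycle_mul (cocycle_ofP n g) _.
rewrite c; exact: cocycle_ofP.
Qed.

Lemma lag_morphism_continuous : continuous h -> continuous lag_morphism.
Proof.
move=> ch; apply: lag_continuous.
- move=> g; apply: (@continuous_comp _ _ _ (@grange a X) h); last exact: ch.
  exact: grange_continuous.
- move=> g; apply: (@continuous_comp _ _ _ (@gsource a X) h); last exact: ch.
  exact: gsource_continuous.
- exact: lag_cocycle_of.
Qed.

End LagCocycle.

(** * Periodicity and isolated points *)

Section Periodic.
Context {a : finType} (X : sft a).
Implicit Types (x y z : X).

Definition isolated_point x : Prop := nbhs x [set x].

(** The equation identifies each coordinate from [J] on with an earlier one, since [I < J]; the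
    first [J] coordinates thus determine the point. *)
Lemma iter_sigma_eq_inj x y I J : (I < J)%N ->
  sigma_n I x = sigma_n J x -> sigma_n I y = sigma_n J y ->
  (forall k, (k < J)%N -> val y k = val x k) -> y = x.
Proof.
move=> IJ ex ey H; apply: val_inj; apply/funext => k.
elim/ltn_ind: k => k IH; have [|Jk] := ltnP k J; first exact: H.
have E (w : X) : sigma_n I w = sigma_n J w -> val w k = val w (I + (k - J))%N.
  move=> /(congr1 (fun w : X => val w (k - J)%N)).
  by rewrite !val_iter_sigma subnKC.
by rewrite (E x) // (E y) // IH //; lia.
Qed.

(* Where [c] and the degree disagree, all ranges near [grange g] satisfy a
   common equation [sigma_n I y = sigma_n J y] with [I <> J], whose solutions
   form a discrete set. *)
Lemma lag_degree_nonisolated (c : groupoid X -> int) g :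
  lag (@grange a X) (@gsource a X) c -> ~ isolated_point (grange g) ->
  c g = gdegree g.
Proof.
move=> /(_ g)[i [j [cE L]]] nis; have [k [l [dE L']]] := groupoid_lag g.
apply/eqP; apply/negPn/negP => cd; apply: nis.
have IJ : (i + l != j + k)%N by apply: contraNneq cd; rewrite cE dE; lia.
have H : nbhs (grange g) [set y | sigma_n (i + l) y = sigma_n (j + k) y].
  refine (filterS _ (grange_open (filterI L L'))).
  move=> _ [g' [[_ e] [_ e']] <-] /=.
  by rewrite addnC iterD e -iterD addnC iterD -e' -iterD.
have eg := nbhs_singleton H.
refine (filterS2 _ _ H (nbhs_shift_cylinder (grange g) (i + l + j + k))).
move=> y ey Py; move: eg ey => /=.
move: IJ; rewrite neq_ltn => /orP[lt|lt] eg ey.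
  by apply: (iter_sigma_eq_inj lt eg ey) => r rJ; apply: Py; lia.
by apply: (iter_sigma_eq_inj lt (esym eg) (esym ey)) => r rJ; apply: Py; lia.
Qed.

(** Letters of [x] are prepended to [y] one at a time. The lengthened point still agrees with the
    tail of [x] on [m] letters, so one [m] serves all [i]. *)
Lemma sft_splice : exists m : nat, forall i x y,
  (forall k, (k < m)%N -> val y k = val x (i + k)%N) ->
  exists z, (forall k, (k < i)%N -> val z k = val x k) /\ sigma_n i z = y.
Proof.
have [m Xm] := sft_extend X; exists m; elim=> [|i IH] x y xy; first by exists y.
have [k km|z [z0 zy]] := Xm (sigma_n i x) y.
  by rewrite val_iter_sigma addnS xy ?addSn.
have [k km|w [wx wz]] := IH x z.
  case: k km => [|k] km; first by rewrite z0 val_iter_sigma addn0.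
  have -> : val z k.+1 = val y k by rewrite -zy.
  by rewrite xy ?addnS //; exact: ltnW.
exists w; split; last by rewrite iterS wz.
move=> k; rewrite ltnS leq_eqVlt => /predU1P[->|]; last exact: wx.
by rewrite -[i in LHS]addn0 -val_iter_sigma wz z0 val_iter_sigma addn0.
Qed.

Lemma isolated_cylinder x : isolated_point x -> exists N, forall y,
  (forall k, (k < N)%N -> val y k = val x k) -> y = x.
Proof. by move=> /shift_space_nbhs[N NH]; exists N => y /NH. Qed.

Lemma iter_sigma_isolated x i :
  isolated_point x -> isolated_point (sigma_n i x).
Proof.
rewrite /isolated_point nbhsE => -[B [oB Bx] Bs].
have oi : open (sigma_n i @` B) by exact: iter_sigma_open.
have ni : nbhs (sigma_n i x) (sigma_n i @` B).
  by apply: open_nbhs_nbhs; split=> //; exists x.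
refine (filterS _ ni).
by move=> _ [y /Bs -> <-].
Qed.

(* Two occurrences far out of the same long word let the tail at the first be
   replaced by the tail at the second, without changing an initial segment
   that already determines [x]. *)
Lemma isolated_eventually_periodic x : isolated_point x ->
  exists i p, (0 < p)%N /\ sigma_n (i + p) x = sigma_n i x.
Proof.
move=> /isolated_cylinder[N xN]; have [m Xm] := sft_splice.
pose w (i : nat) : m.-tuple a := [tuple val x (N + i + k)%N | k < m].
pose f (r : 'I_(#|{: m.-tuple a}|.+1)) := w r.
(* Pigeonhole: there are more positions than words of length [m]. *)
have /injectivePn[r [s rs /= fE]] : ~~ injectiveb f.
  apply/negP => /injectiveP /leq_card.
  by rewrite card_ord ltnn.
wlog {rs} rs : r s fE / (r < s)%N.
  move=> H; case: (ltngtP r s) => [|sr|/val_inj e]; first exact: H.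
    exact: (H s r).
  by rewrite e eqxx in rs.
have [k km|z [zx zs]] := Xm (N + r)%N x (sigma_n (N + s) x).
  rewrite val_iter_sigma.
  by have := congr1 (fun t => tnth t (Ordinal km)) fE; rewrite !tnth_mktuple.
exists (N + r)%N, (s - r)%N; split; first by rewrite subn_gt0.
rewrite -addnA subnKC 1?ltnW // -zs; congr (sigma_n _ _).
by apply: xN => k kN; apply: zx; lia.
Qed.

Definition isolated_periodic x : Prop :=
  isolated_point x /\ exists2 p : nat, (0 < p)%N & sigma_n p x = x.

Lemma iter_periodic x p k : sigma_n p x = x -> sigma_n (k * p) x = x.
Proof.
by move=> xp; elim: k => // k IH; rewrite mulSn iterD IH.
Qed.

(** The point is that [m] does not depend on [x]. Whole periods of [x], long enough to determine
    [x], can be spliced in front of [y]; the result is [x], and shifting it back by these periods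
    gives [y = x]. *)
Lemma isolated_periodic_cylinder : exists m : nat, forall x y,
  isolated_periodic x -> (forall k, (k < m)%N -> val y k = val x k) -> y = x.
Proof.
have [m Xm] := sft_splice; exists m => x y.
move=> [/isolated_cylinder[N xN] [p p0 xp]] yx.
have xNp := iter_periodic N xp.
have [k km|z [zx zy]] := Xm (N * p)%N x y.
  by rewrite -val_iter_sigma xNp yx.
suff zE : z = x by rewrite -zy zE.
by apply: xN => k kN; apply: zx; rewrite (leq_trans kN) // leq_pmulr.
Qed.

Lemma isolated_orbit x : isolated_point x ->
  exists i, isolated_periodic (sigma_n i x).
Proof.
move=> ix; have [i [p [p0 ip]]] := isolated_eventually_periodic ix.
exists i; split; first exact: iter_sigma_isolated.
by exists p => //; rewrite -iterD addnC.
Qed.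

Lemma isolated_isotropy x : isolated_point x -> exists2 d, d != 0 & arrow x d x.
Proof.
move=> ix; have [i [p [p0 ip]]] := isolated_eventually_periodic ix.
exists p%:Z; first by rewrite eqz_nat -lt0n.
by exists (i + p)%N, i; split=> //=; lia.
Qed.

Lemma periodic_arrow x p (d : nat) : (0 < p)%N -> sigma_n p x = x ->
  arrow x d%:Z x -> sigma_n d x = x.
Proof.
move=> p0 xp [i [j [/= dE e]]].
have iE : i = (j + d)%N by lia.
(* Raises the exponent [j] to a multiple of the period, where the iterate fixes [x]. *)
have {}e := congr1 (iter (j * p - j) (@sigma a X)) e.
have jp : (j <= j * p)%N by rewrite leq_pmulr.
rewrite iE -!iterD addnA subnK // (iter_periodic j xp) in e.
by rewrite addnC iterD (iter_periodic j xp) in e.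
Qed.

End Periodic.

(** * Repairing the cocycle on isotropy at isolated points *)

Section Adjust.
Context {a b : finType} (X : sft a) (Y : sft b).
Implicit Types (x y z s : X) (n : X -> int).

(** Injectivity is put as triviality of the kernel, which is enough because the cocycle is
    additive. *)
Definition isotropy_bij (h : X -> Y) n x : Prop :=
  (forall t, cocycle n x t x 0 -> t = 0) /\
  (forall m, arrow (h x) m (h x) -> exists t, cocycle n x t x m).

(** Conjugation by the arrow carries loops at [x] to loops at [y], and its image does the same in
    [Y]. *)
Lemma isotropy_bij_arrow (h : X -> Y) n x d y :
  lag h (h \o @sigma a X) n -> arrow x d y ->
  isotropy_bij h n y -> isotropy_bij h n x.
Proof.
move=> hn xy [inj surj]; have [v xvy] := cocycle_ex n xy.
have yvx := cocycle_inv xvy; split=> [t tx|m mx].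
  have := cocycle_mul (cocycle_mul yvx tx) xvy.
  by rewrite addr0 addNr => /inj; lia.
have [t ty] := surj _ (arrow_mul (arrow_mul (cocycle_lag_arrow hn yvx) mx)
  (cocycle_lag_arrow hn xvy)).
exists (d + t - d).
have := cocycle_mul (cocycle_mul xvy ty) yvx.
by congr cocycle; lia.
Qed.

(* The cocycle along the cycle of [s] becomes [q], the generator of the
   isotropy group at [h s], after changing [n] only at [s]. *)
Lemma adjust_at (h : X -> Y) n s :
  lag h (h \o @sigma a X) n -> isolated_periodic s -> isolated_point (h s) ->
  exists v, arrow (h s) v (h (sigma s)) /\
    forall n', n' s = v ->
      (forall r, sigma_n r s <> s -> n' (sigma_n r s) = n (sigma_n r s)) ->
      isotropy_bij h n' s.
Proof.
move=> hn [is_ [P P0 sP]] ihs.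
have [p p0 pgen] : exists2 p : nat, (0 < p)%N &
    forall d, arrow s d s <-> exists t : int, d = t * p%:Z.
  apply: (@isotropy_gen _ _ _ P%:Z); first by rewrite eqz_nat -lt0n.
  by rewrite -{2}sP; exact: arrow_sigma.
have [d d0 hd] := isolated_isotropy ihs.
have [q q0 qgen] := isotropy_gen d0 hd.
have sp : sigma_n p s = s.
  by apply: (periodic_arrow P0 sP); apply/pgen; exists 1; rewrite mul1r.
pose C := birkhoff n p s.
have hC : arrow (h s) C (h s).
  by have := cocycle_lag_arrow hn (cocycle_sig n s p); rewrite sp.
have hq : arrow (h s) q%:Z (h s) by apply/qgen; exists 1; rewrite mul1r.
exists (q%:Z - C + n s); split.
  apply: (arrow_mul (arrow_mul hq (arrow_inv hC))).
  exact: (lag_at_arrow (hn s)).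
move=> n' n's n'n.
have Bq : birkhoff n' p s = q%:Z.
  have : birkhoff n' p s - n' s = C - n s.
    rewrite /C /birkhoff; case: (p) p0 pgen => // p' _ pgen'.
    rewrite !big_ord_recl ![_ s + _]addrC !addrK.
    (* The remaining terms sit at proper iterates of order below [p]. None of these returns to [s],
       as [p] divides every return time. *)
    apply: eq_bigr => i _; rewrite !lift0; apply: n'n => e.
    have := arrow_sigma i.+1 s; rewrite e => /pgen'[t].
    move: (nat_of_ord i) (ltn_ord i) => j jp jE.
    have t0 : 0 < t by nia.
    by have : p'.+1%:Z <= j.+1%:Z; [rewrite jE; nia|lia].
  rewrite n's; lia.
have sq : cocycle n' s p%:Z s q%:Z.
  by have := cocycle_sig n' s p; rewrite sp Bq.
split=> [t t0|m /qgen[t ->]].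
  have [t' tE] := (pgen t).1 (cocycle_arrow t0); rewrite tE in t0.
  have := cocycle_fun t0 (cocycle_mulz t' sq); rewrite tE; nia.
by exists (t * p%:Z); exact: cocycle_mulz.
Qed.

Lemma iter_sigma_orbit x r P : (0 < P)%N -> sigma_n P x = x ->
  range (fun k => sigma_n k (sigma_n r x)) = range (fun k => sigma_n k x).
Proof.
move=> P0 xP; apply/seteqP; split=> _ [k _ <-].
  by exists (k + r)%N => //; rewrite iterD.
exists (k + (r * P - r))%N => //.
by rewrite -iterD -addnA subnK ?leq_pmulr // iterD iter_periodic.
Qed.

(** The representative is chosen from the forward orbit as a set, which is the same for all points
    of one cycle. *)
Lemma isolated_transversal : exists S : set X,
  [/\ S `<=` @isolated_periodic a X,
      forall s r, S s -> S (sigma_n r s) -> sigma_n r s = s &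
      forall x, isolated_periodic x -> exists r, S (sigma_n r x)].
Proof.
have [[x0 _]|X0] := pselect (exists x : X, True); last first.
  by exists set0; split=> // x; case: X0; exists x.
pose rep x := xget x0 (range (fun k => sigma_n k x)).
exists [set x | isolated_periodic x /\ rep x = x]; split=> [x []//|s r|x px].
  move=> [[_ [P P0 sP]] es] [_ er].
  by rewrite -er -[in RHS]es /rep (iter_sigma_orbit _ P0 sP).
have [ix [P P0 xP]] := px.
have : range (fun k => sigma_n k x) (rep x).
  by apply: xgetPex; exists x, 0%N.
move=> [r _ re]; exists r; split.
  split; first exact: iter_sigma_isolated.
  by exists P => //; rewrite -iterD addnC iterD xP.
by rewrite {1}/rep (iter_sigma_orbit _ P0 xP) -/(rep x).
Qed.

Lemma lag_adjust (h : X -> Y) n :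
  lag h (h \o @sigma a X) n ->
  (forall x, isolated_point x -> isolated_point (h x)) ->
  exists2 n', lag h (h \o @sigma a X) n' &
    forall x, isolated_point x -> isotropy_bij h n' x.
Proof.
move=> hn hi; have [S [Sp S1 Sx]] := isolated_transversal.
have /choice[v vP] x : exists v, S x -> arrow (h x) v (h (sigma x)) /\
    forall n', n' x = v ->
      (forall r, sigma_n r x <> x -> n' (sigma_n r x) = n (sigma_n r x)) ->
      isotropy_bij h n' x.
  have [Sx'|] := pselect (S x); last by exists 0.
  have [v vP] := adjust_at hn (Sp _ Sx') (hi _ (Sp _ Sx').1).
  by exists v.
pose n' x := if `[< S x >] then v x else n x.
have n'S x : S x -> n' x = v x by rewrite /n'; case: asboolP.
have n'N x : ~ S x -> n' x = n x by rewrite /n'; case: asboolP.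
have hn' : lag h (h \o @sigma a X) n'.
  move=> x; have [Sx'|NSx] := pselect (S x).
    apply: lag_at_isolated; first exact: (Sp _ Sx').1.
    by rewrite n'S //; exact: (vP x Sx').1.
  (* The uniform [m] keeps points of [S] from accumulating at [x], so [n'] agrees with [n] near
     [x]. *)
  have [m mP] := isolated_periodic_cylinder X.
  apply: lag_at_near (hn x).
  refine (filterS _ (nbhs_shift_cylinder x m)) => y Py; split=> //.
  apply: n'N => Sy; apply: NSx; suff -> : x = y by [].
  by apply: mP (Sp _ Sy) _ => k km; rewrite Py.
exists n' => // x ix; have [i ip] := isolated_orbit ix.
have [r Sr] := Sx _ ip.
(* The forward orbit of [x] meets [S], where the cocycle has been repaired. *)
apply: isotropy_bij_arrow hn' (arrow_mul (arrow_sigma i x) (arrow_sigma r _)) _.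
apply: (vP _ Sr).2; first exact: n'S.
by move=> k ne; apply: n'N => Sk; apply: ne; exact: S1.
Qed.

End Adjust.

(** * A criterion for the induced morphism to be a homeomorphism *)

Section Isomorphism.
Context {a b : finType} (X : sft a) (Y : sft b).

(* A continuous bijection between the groupoids is open as soon as it covers a
   homeomorphism of the units, because basic open sets are bisections. *)
Lemma lag_morphism_homeomorphism (h : X -> Y) (hinv : Y -> X) n
    (hn : lag h (h \o @sigma a X) n) :
  homeomorphism h hinv -> (forall x, isotropy_bij h n x) ->
  (forall x y v, arrow (h x) v (h y) -> exists d, arrow x d y) ->
  exists psi, homeomorphism (lag_morphism hn) psi.
Proof.
move=> [hK hinvK ch chinv] bij ex; set phi := lag_morphism hn.
have phi_inj : injective phi.
  move=> g g' e.
  have r : grange g = grange g'.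
    by rewrite -[LHS]hK -[RHS]hK; exact: (congr1 (hinv \o @grange _ _) e).
  have s : gsource g = gsource g'.
    by rewrite -[LHS]hK -[RHS]hK; exact: (congr1 (hinv \o @gsource _ _) e).
  have d : cocycle_of n g = cocycle_of n g' := congr1 (@gdegree _ _) e.
  apply: groupoid_eq => //.
  (* The product of [g] with the inverse of [g'] is a loop with cocycle value zero. *)
  have c := cocycle_ofP n g; have c' := cocycle_inv (cocycle_ofP n g').
  rewrite s in c; have := cocycle_mul c c'; rewrite -r d subrr.
  by move=> /(bij _).1; lia.
have phi_surj k : exists g, phi g = k.
  have := arrowP k; rewrite -(hinvK (grange k)) -(hinvK (gsource k)).
  set x := hinv _; set y := hinv _ => kP; have [d xy] := ex _ _ _ kP.
  have [v xvy] := cocycle_ex n xy.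
  (* Some arrow from [x] to [y] exists; the error in its value is a loop at [h x], which lifts to a
     loop at [x]. *)
  have [t tP] := (bij x).2 _
    (arrow_mul kP (arrow_inv (cocycle_lag_arrow hn xvy))).
  have c := cocycle_mul tP xvy.
  exists (mk_arrow (cocycle_arrow c)); apply: groupoid_eq.
  - exact: hinvK.
  - by rewrite [LHS](cocycle_ofE (v := gdegree k - v + v)) ?subrK.
  - exact: hinvK.
have [psi psiK] := choice phi_surj.
have phiK : cancel phi psi by move=> g; apply: phi_inj; rewrite psiK.
have cphi : continuous phi by exact: lag_morphism_continuous.
exists psi; split=> // k A Ak.
have [g gk] := phi_surj k; rewrite -gk phiK in Ak *.
have [p [Dp pg _]] := nbhs_gbasic (@filterT _ (nbhs (phi g)) _).
have AB : nbhs g (A `&` phi @^-1` (gbasic p)).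
  by apply: filterI => //; apply: (cphi g); exact: gbasic_nbhs.
pose R := @grange a X @` (A `&` phi @^-1` (gbasic p)).
have rk : \forall k' \near phi g, R (hinv (grange k')).
  have c : {for phi g, continuous (hinv \o @grange b Y)}.
    by apply: continuous_comp; [exact: grange_continuous|exact: chinv].
  by apply: (c R); rewrite /= hK; exact: grange_open.
refine (filterS2 _ _ (gbasic_nbhs Dp pg) rk) => k' pk' [g' [Ag' pg'] rg'].
suff -> : k' = phi g' by rewrite /= phiK.
apply: (gbasic_inj Dp); rewrite ?inE //.
by rewrite -[LHS]hinvK -rg'.
Qed.

End Isomorphism.

(** * From orbit equivalence to isomorphism *)

Section OrbitEquivalence.
Context {a b : finType} (X : sft a) (Y : sft b).

Lemma continuous_discrete_near (T : topologicalType) (k : T -> nat) t :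
  continuous k -> \forall t' \near t, k t' = k t.
Proof. by move=> ck; exact: (ck t _ (discrete_set1 (k t))). Qed.

Lemma lag_orbit_map (h : X -> Y) (k l : X -> nat) :
  continuous k -> continuous l ->
  (forall x, sigma_n (k x) (h (sigma x)) = sigma_n (l x) (h x)) ->
  lag h (h \o @sigma a X) (fun x => (l x)%:Z - (k x)%:Z).
Proof.
move=> ck cl e x; exists (l x), (k x); split=> //.
apply: filterS2 (continuous_discrete_near x ck) (continuous_discrete_near x cl).
by move=> y /= ky ly; rewrite ky ly -ky -ly e.
Qed.

Lemma isolated_homeomorphism (h : X -> Y) hinv : homeomorphism h hinv ->
  forall x, isolated_point x -> isolated_point (h x).
Proof.
move=> [hK hinvK _ chinv] x ix.
have : nbhs (h x) (hinv @^-1` [set x]) by apply: (chinv (h x)); rewrite hK.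
by move=> H; refine (filterS _ H) => y /= <-; rewrite hinvK.
Qed.

End OrbitEquivalence.

(** The composite of the two cocycles is a lag between range and source, so [lag_degree_nonisolated]
    identifies it with the degree. *)
Lemma lag_composite {a b : finType} (X : sft a) (Y : sft b)
    (h : X -> Y) (hinv : Y -> X) n n' :
  homeomorphism h hinv -> lag h (h \o @sigma a X) n ->
  lag hinv (hinv \o @sigma b Y) n' ->
  forall g v, ~ isolated_point (grange g) ->
  cocycle n (grange g) (gdegree g) (gsource g) v ->
  cocycle n' (h (grange g)) v (h (gsource g)) (gdegree g).
Proof.
move=> [hK hinvK ch _] hn hn' g v nis gv.
have L := lag_comp (lag_morphism_continuous (hn := hn) ch) (lag_cocycle_of hn').
have {}L : lag (@grange a X) (@gsource a X)
    (cocycle_of n' \o lag_morphism hn).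
  by move=> g'; apply: lag_at_eq (L g') => // g'' /=; rewrite hK.
rewrite -(lag_degree_nonisolated L nis) -(cocycle_ofE gv).
exact: (cocycle_ofP n' (lag_morphism hn g)).
Qed.

(** Only [n] is adjusted. The cocycle of [n'] is inverted only at non-isolated points; elsewhere it
    serves merely to pull an arrow of [Y] back to some arrow of [X]. *)
Lemma orbit_equivalent_isomorphic {a b : finType} (X : sft a) (Y : sft b) :
  continuously_orbit_equivalent X Y -> groupoid_isomorphic X Y.
Proof.
move=> [h [hinv [k [l [k' [l' [hh [ck cl ck' cl'] e e']]]]]]].
have [n hn nbij] := lag_adjust (lag_orbit_map ck cl e)
  (isolated_homeomorphism hh).
have hn' := lag_orbit_map ck' cl' e'; set n' := fun y => _ in hn'.
have [hK hinvK ch chinv] := hh.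
have hh' : homeomorphism hinv h by split.
have back x y v : arrow (h x) v (h y) -> exists2 d, arrow x d y &
    cocycle n' (h x) v (h y) d.
  move=> H; have [d dP] := cocycle_ex n' H; exists d => //.
  by have := cocycle_lag_arrow hn' dP; rewrite !hK.
have [|x y v /back[d]|psi H] := lag_morphism_homeomorphism hn hh.
- move=> x; have [/nbij//|nis] := pselect (isolated_point x).
  split=> [t t0|m mx].
    have xt := cocycle_arrow t0.
    have := @lag_composite _ _ _ _ _ _ _ _ hh hn hn' (mk_arrow xt) 0 nis t0.
    by move/cocycle_fun; apply; exact: cocycle_unit.
  have [d xd hd] := back _ _ _ mx; exists d.
  have nis' : ~ isolated_point (h x).
    by move=> /(isolated_homeomorphism hh'); rewrite hK.
  have := @lag_composite _ _ _ _ _ _ _ _ hh' hn' hn (mk_arrow mx) d nis' hd.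
  by rewrite /grange /gsource /= !hK.
- by exists d.
- by exists (lag_morphism hn), psi; split=> //; exact: lag_morphism_hom.
Qed.

(** * Uniform bounds from compactness *)

Section Compactness.
Context {a : finType}.

Lemma shift_space_compact (X : shift_space a) : compact (shift_set X).
Proof.
apply: subclosed_compact (shift_closed (s := X)) _ (@subsetT _ _).
have fin : finite_set [set: discrete_topology a] by exact: (@finite_finset a).
have := @tychonoff nat (fun=> discrete_topology a) (fun=> setT)
  (fun=> finite_compact fin).
by congr compact; apply/seteqP; split.
Qed.

Lemma shift_space_uniform (X : shift_space a) (P : nat -> X -> Prop) :
  (forall i j x, (i <= j)%N -> P i x -> P j x) ->
  (forall x : X, exists i, \forall y \near x, P i y) ->
  exists i, forall x, P i x.
Proof.
move=> Pmono Ploc.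
have := (compact_near_coveringP _).1 (shift_space_compact (X := X)).
(* Compactness concerns a subset of the full shift, so the predicate is transferred to points of the
   full shift by quantifying over their lifts to [X]. *)
move=> /(_ nat \oo (fun i x => forall y : X, val y = x -> P i y)) [|N _ NP].
  move=> x Xx; have [i] := Ploc (exist _ x (mem_set Xx)).
  move=> /shift_space_nbhs[N NP].
  exists (cylinder x N, [set j | (i <= j)%N]) => /=.
    split; last by exists i.
    by apply: open_nbhs_nbhs; split; [exact: cylinder_open|].
  move=> [z j] /= [zN ij] y yz; apply: Pmono ij _.
  by apply: NP => k kN; move: (zN k kN); rewrite -yz.
by exists N => x; apply: (NP N) (set_valP x) _ _ => /=.
Qed.

End Compactness.

(** * From isomorphism to orbit equivalence *)

Section UnitMap.
Context {a b : finType} (X : sft a) (Y : sft b).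
Context (phi : groupoid X -> groupoid Y).

Definition unit_map (x : X) : Y := grange (phi (gunit x)).

Lemma hom_grange g : groupoid_hom phi ->
  grange (phi g) = unit_map (grange g).
Proof.
move=> H; have c : composable (gunit (grange g)) g by [].
by have [c' _] := H _ _ c; rewrite -c' groupoid_hom_unit.
Qed.

Lemma hom_gsource g : groupoid_hom phi ->
  gsource (phi g) = unit_map (gsource g).
Proof.
move=> H; have c : composable g (gunit (gsource g)) by [].
by have [c' _] := H _ _ c; rewrite c'.
Qed.

Lemma unit_map_continuous : continuous phi -> continuous unit_map.
Proof.
move=> cphi x; apply: (@continuous_comp _ _ _ (phi \o @gunit a X)).
  by apply: continuous_comp; [exact: gunit_continuous|exact: cphi].
exact: grange_continuous.
Qed.

Definition gsigma (x : X) : groupoid X := mk_arrow (arrow_sigma 1 x).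

Lemma gsigma_continuous : continuous gsigma.
Proof.
apply: lag_continuous.
- by move=> x; exact: cvg_id.
- exact: sigma_continuous.
- exact: (@lag_const _ _ _ _ _ _ 1%N 0%N).
Qed.

Lemma unit_map_orbit : groupoid_hom phi -> continuous phi ->
  exists k l : X -> nat, [/\ continuous k, continuous l &
    forall x, sigma_n (k x) (unit_map (sigma x)) = sigma_n (l x) (unit_map x)].
Proof.
move=> H cphi; pose n := @gdegree b Y \o phi \o gsigma.
have L : lag unit_map (unit_map \o @sigma a X) n.
  have cf : continuous (phi \o gsigma).
    move=> x; apply: continuous_comp; last exact: cphi.
    exact: gsigma_continuous.
  move=> x; apply: lag_at_eq (lag_comp cf (@groupoid_lag _ Y) x) => // y /=.
    by rewrite hom_grange.
  by rewrite hom_gsource.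
(* Compactness bounds the number of iterations at [unit_map phi x], which can
   then be taken constant. *)
have [A nA] : exists A : nat, forall x, exists i j : nat,
    [/\ (i <= A)%N, n x = i%:Z - j%:Z &
      sigma_n i (unit_map x) = sigma_n j (unit_map (sigma x))].
  apply: shift_space_uniform => [i j x ij [k [l [ki e e']]]|x].
    by exists k, l; split=> //; exact: leq_trans ij.
  have [i [j [nx Lx]]] := L x; exists i.
  by refine (filterS _ Lx) => y [ny e]; exists i, j; split=> //; rewrite ny.
(* The absolute value changes nothing: [A - n x] equals [(A - i) + j] with [i <= A]. *)
exists (fun x => `|A%:Z - n x|%N), (fun=> A); split=> [x U Ux|x|x].
- have [i [j [_ Lx]]] := L x; refine (filterS _ Lx) => y /= [-> _].
  exact: (nbhs_singleton Ux).
- exact: (@cst_continuous X nat A).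
have [i [j [iA nx e]]] := nA x.
have -> : `|A%:Z - n x|%N = (A - i + j)%N by lia.
by rewrite -[in RHS](subnK iA) !iterD e.
Qed.

End UnitMap.

Lemma unit_mapK {a b : finType} (X : sft a) (Y : sft b)
    (phi : groupoid X -> groupoid Y) psi : groupoid_hom phi ->
  cancel phi psi -> cancel (unit_map phi) (unit_map psi).
Proof.
by move=> H phiK x; rewrite {1}/unit_map -groupoid_hom_unit // phiK.
Qed.

Lemma groupoid_hom_inverse {a b : finType} (X : sft a) (Y : sft b)
    (phi : groupoid X -> groupoid Y) psi : groupoid_hom phi ->
  cancel phi psi -> cancel psi phi -> groupoid_hom psi.
Proof.
move=> H phiK psiK g g' c.
(* Composability can be tested after the injective map [unit_map phi], where it becomes that of [g]
   and [g']. *)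
have c' : composable (psi g) (psi g').
  apply: (can_inj (unit_mapK H phiK)).
  by rewrite -hom_gsource // -hom_grange // !psiK.
exists c'; rewrite -[RHS]phiK; congr psi.
have [c'' ->] := H _ _ c'.
apply: groupoid_eq; rewrite /grange /gdegree /gsource /=.
- by rewrite psiK.
- by rewrite !psiK.
- by rewrite psiK.
Qed.

Lemma isomorphic_orbit_equivalent {a b : finType} (X : sft a) (Y : sft b) :
  groupoid_isomorphic X Y -> continuously_orbit_equivalent X Y.
Proof.
move=> [phi [psi [[phiK psiK cphi cpsi] H]]].
have H' := groupoid_hom_inverse H phiK psiK.
have [k [l [ck cl e]]] := unit_map_orbit H cphi.
have [k' [l' [ck' cl' e']]] := unit_map_orbit H' cpsi.
exists (unit_map phi), (unit_map psi), k, l, k', l'; split=> //.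
split; [exact: unit_mapK|exact: unit_mapK|..].
- exact: unit_map_continuous.
- exact: unit_map_continuous.
Qed.

Theorem theorem5p1 (a b : finType) (X : sft a) (Y : sft b) :
  continuously_orbit_equivalent X Y <-> groupoid_isomorphic X Y.
Proof.
split; first exact: orbit_equivalent_isomorphic.
exact: isomorphic_orbit_equivalent.
Qed.
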